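(* The infinite sequence $\{(-1)^{n}b_{n+1}\}_{n\ge0}$, where $b_n$ are the Bernoulli numbers of the second kind, is completely monotonic and minimal.
   Context: The Bernoulli numbers of the second kind $b_n$, $n\ge 0$, are the real numbers defined by the power series expansion (around $x=0$) $\frac{x}{\ln(1+x)}=\sum_{n=0}^\infty b_nx^n$, where the left-hand side is given its limit value $1$ at $x=0$. A real sequence $\{\mu_n\}_{n\ge0}$ is completely monotonic if its elements are non-negative and $(-1)^k\Delta^k\mu_n\ge0$ for all integers $n,k\ge0$, where $\Delta^k\mu_n=\sum_{m=0}^k(-1)^m\binom{k}{m}\mu_{n+k-m}$. A completely monotonic sequence $\{a_n\}_{n\ge0}$ is minimal if it ceases to be completely monotonic when $a_0$ is decreased, i.e. for every $\varepsilon>0$ the sequence $a_0-\varepsilon,a_1,a_2,\dotsc$ is not completely monotonic. *)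

(* Defs.v *)
From Stdlib Require Import Reals.
From Coquelicot Require Import Coquelicot.
Open Scope R_scope.

Definition x_over_ln1p (x : R) : R :=
  if Req_EM_T x 0 then 1 else x / ln (1 + x).

(* Such a sequence [b] is unique, since a real power series is determined by
   its sum near 0. *)
Definition is_bernoulli_second_kind (b : nat -> R) : Prop :=
  exists r : R, 0 < r /\
    forall x : R, Rabs x < r -> is_pseries b x (x_over_ln1p x).

(* The binomial is qualified because Coquelicot's [C] is the type of complex
   numbers. *)
Definition delta (k : nat) (mu : nat -> R) (n : nat) : R :=
  sum_f_R0 (fun m => (-1) ^ m * Binomial.C k m * mu (n + k - m)%nat) k.

Definition completely_monotonic (mu : nat -> R) : Prop :=
  (forall n : nat, 0 <= mu n) /\
  (forall n k : nat, 0 <= (-1) ^ k * delta k mu n).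

Definition decrease_head (eps : R) (a : nat -> R) (n : nat) : R :=
  match n with
  | O => a O - eps
  | S _ => a n
  end.

Definition minimal (a : nat -> R) : Prop :=
  completely_monotonic a /\
  forall eps : R, 0 < eps -> ~ completely_monotonic (decrease_head eps a).

(* Main.v *)
Require Import Defs.
From Stdlib Require Import Reals.
From Coquelicot Require Import Coquelicot.
From Stdlib Require Import Lra Lia Arith.
Open Scope R_scope.

(* Integrating [(1+x)^s] over [0 <= s <= 1] gives [x / ln (1+x)], so [b_n] is
   the integral of the binomial coefficient [binom(s, n)]. For fixed [s], the
   numbers [(-1)^n binom(s, n+1)] are up to a positive factor the moments of a
   Beta density, and their [k]-th differences have the closed form
   [s (1-s)_n (1+s)_k / (n+k+1)!] (rising factorials), which is nonnegative.
   At [n = 0] this is at most [exp (-(1-s) ln (k+2))], whose integral tends to 0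
   as [k] grows: the differences at [0] have infimum 0 and leave no room for
   lowering the first term. *)

(** * The power series of [ln (1 + x)] *)

Lemma lt_CV_radius (a : nat -> R) (r x : R) :
  (forall y, Rabs y < r -> ex_pseries a y) -> Rabs x < r ->
  Rbar_lt (Rabs x) (CV_radius a).
Proof.
  intros Ha Hx.
  pose proof (Rabs_pos x).
  destruct (Rbar_lt_le_dec (Rabs x) (CV_radius a)) as [Hlt | Hle]; [exact Hlt | exfalso].
  (* The midpoint lies strictly beyond [Rabs x] but still below [r]: the series converges there,
     although a radius at most [Rabs x] would put [y] outside the disk of convergence. *)
  set (y := (Rabs x + r) / 2).
  assert (Hy : Rabs y = y) by (apply Rabs_pos_eq; unfold y; lra).
  apply (CV_disk_outside a y).
  - apply Rbar_le_lt_trans with (1 := Hle). simpl. rewrite Hy. unfold y. lra.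
  - apply ex_series_lim_0, ex_pseries_R, Ha. rewrite Hy. unfold y. lra.
Qed.

Definition log_coef (n : nat) : R :=
  match n with
  | O => 0
  | S m => (-1) ^ m / INR (S m)
  end.

Lemma PS_derive_log_coef (n : nat) : PS_derive log_coef n = (-1) ^ n.
Proof.
  unfold PS_derive, log_coef. field. apply not_0_INR. discriminate.
Qed.

Lemma is_pseries_derive_log_coef (x : R) :
  Rabs x < 1 -> is_pseries (PS_derive log_coef) x (/ (1 + x)).
Proof.
  intros Hx.
  apply is_pseries_R.
  replace (1 + x) with (1 - - x) by ring.
  apply is_series_ext with (fun n => (- x) ^ n).
  - intros n. rewrite PS_derive_log_coef, <- Rpow_mult_distr. f_equal. ring.
  - apply is_series_geom. now rewrite Rabs_Ropp.
Qed.

Lemma lt_CV_radius_log_coef (x : R) :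
  Rabs x < 1 -> Rbar_lt (Rabs x) (CV_radius log_coef).
Proof.
  intros Hx. rewrite <- CV_radius_derive.
  apply lt_CV_radius with 1; [| exact Hx].
  intros y Hy. eexists. now apply is_pseries_derive_log_coef.
Qed.

(** Both sides have derivative [/ (1 + x)] and vanish at 0, so the mean value theorem makes their
    difference zero. *)
Lemma PSeries_log_coef (x : R) : Rabs x < 1 -> PSeries log_coef x = ln (1 + x).
Proof.
  intros Hx.
  set (f := fun t => PSeries log_coef t - ln (1 + t)).
  assert (Hd : forall t, Rabs t < 1 -> is_derive f t 0).
  { intros t Ht. unfold f.
    replace 0 with (minus (/ (1 + t)) (/ (1 + t))) by apply Rminus_diag.
    apply (is_derive_minus (K := R_AbsRing) (V := R_NormedModule)).
    - rewrite <- (is_pseries_unique _ _ _ (is_pseries_derive_log_coef t Ht)).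
      apply is_derive_PSeries. now apply lt_CV_radius_log_coef.
    - apply Rabs_def2 in Ht. auto_derive; [lra | field; lra]. }
  assert (Hsub : forall t, Rmin 0 x <= t <= Rmax 0 x -> Rabs t < 1).
  { intros t Ht. apply Rabs_def2 in Hx.
    unfold Rmin, Rmax in Ht. destruct (Rle_dec 0 x); apply Rabs_def1; lra. }
  destruct (MVT_gen f 0 x (fun _ => 0)) as [c [_ Hc]].
  - intros t Ht. apply Hd, Hsub. lra.
  - intros t Ht. apply continuity_pt_filterlim.
    apply (ex_derive_continuous (K := R_AbsRing) (V := R_NormedModule)).
    exists 0. now apply Hd, Hsub.
  - unfold f in Hc. rewrite PSeries_0, Rplus_0_r, ln_1 in Hc.
    unfold log_coef at 2 in Hc. lra.
Qed.

(** * The convolution equation that determines the Bernoulli numbers *)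

(** The Cauchy product of the two series represents [x / ln (1 + x)] times [ln (1 + x)], that is
    [x], near 0; coefficients are then compared. *)
Lemma bernoulli_second_kind_conv (b : nat -> R) :
  is_bernoulli_second_kind b ->
  forall n, PS_mult b log_coef n = match n with 1%nat => 1 | _ => 0 end.
Proof.
  intros [r [Hr Hb]] n.
  set (d := fun n => match n with 1%nat => 1 | _ => 0 end).
  assert (Hrb : forall x, Rabs x < r -> Rbar_lt (Rabs x) (CV_radius b)).
  { intros x. apply lt_CV_radius. intros y Hy. eexists. now apply Hb. }
  assert (Hm : forall x, Rabs x < Rmin r 1 ->
            is_pseries (PS_mult b log_coef) x x).
  { intros x Hx.
    pose proof (Rmin_l r 1). pose proof (Rmin_r r 1).
    assert (H1 : Rabs x < 1) by lra.
    assert (E : x = x_over_ln1p x * PSeries log_coef x).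
    { rewrite PSeries_log_coef by exact H1. unfold x_over_ln1p.
      destruct (Req_EM_T x 0) as [-> | Hx0].
      - rewrite Rplus_0_r, ln_1. ring.
      - apply Rabs_def2 in H1. field. intros E. apply Hx0.
        assert (1 + x = 1) by (apply ln_inv; try lra; rewrite ln_1; exact E). lra. }
    rewrite E at 2.
    apply is_pseries_mult.
    - apply Hb. lra.
    - apply PSeries_correct, CV_radius_inside. now apply lt_CV_radius_log_coef.
    - apply Hrb. lra.
    - now apply lt_CV_radius_log_coef. }
  assert (Hd : forall x, is_pseries d x x).
  { intros x. apply is_pseries_R.
    replace x with (0 + (x + 0)) at 2 by ring.
    apply is_series_decr_1, is_series_decr_1.
    unfold d. simpl.
    match goal with |- is_series _ ?l => replace l with 0 end.
    - apply is_series_ext with (fun _ => 0); [intros; simpl; ring |].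
      apply filterlim_ext with (fun _ => 0); [| apply filterlim_const].
      intros k. now rewrite sum_n_const, Rmult_0_r.
    - unfold plus, opp. simpl. ring. }
  assert (Hpos : 0 < Rmin r 1) by (apply Rmin_pos; lra).
  apply (PSeries_ext_recip _ d).
  - rewrite <- Rabs_R0. apply lt_CV_radius with (Rmin r 1).
    + intros y Hy. exists y. now apply Hm.
    + now rewrite Rabs_R0.
  - rewrite <- Rabs_R0. apply lt_CV_radius with 1.
    + intros y _. exists y. apply Hd.
    + rewrite Rabs_R0. lra.
  - exists (mkposreal _ Hpos). intros y Hy.
    rewrite (is_pseries_unique _ _ _ (Hd y)).
    apply is_pseries_unique, Hm.
    unfold ball in Hy. simpl in Hy. unfold AbsRing_ball, abs, minus, plus, opp in Hy.
    simpl in Hy. now rewrite Ropp_0, Rplus_0_r in Hy.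
Qed.

(** As [log_coef] is 0 at 0 and 1 at 1, the product coefficient of index [S n] is [b n] plus a
    combination of the [b k] with [k < n], and strong induction recovers [b n]. *)
Lemma PS_mult_log_coef_inj (b c : nat -> R) :
  (forall n, PS_mult b log_coef n = PS_mult c log_coef n) ->
  forall n, b n = c n.
Proof.
  intros H n. induction n as [n IH] using (well_founded_induction lt_wf).
  assert (H0 : log_coef 0 = 0) by reflexivity.
  assert (H1 : log_coef 1 = 1) by (unfold log_coef; simpl; field).
  specialize (H (S n)). unfold PS_mult in H.
  rewrite !tech5, Nat.sub_diag, H0 in H.
  destruct n as [| n].
  - cbn [sum_f_R0] in H. rewrite Nat.sub_0_r, H1 in H. lra.
  - rewrite !tech5 in H.
    replace (S (S n) - S n)%nat with 1%nat in H by lia.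
    rewrite H1 in H.
    rewrite (sum_eq (fun k => b k * log_coef (S (S n) - k))
                    (fun k => c k * log_coef (S (S n) - k))) in H.
    + lra.
    + intros i Hi. rewrite IH by lia. reflexivity.
Qed.

(** * Generalized binomial coefficients and their integrals over [0, 1] *)

Fixpoint gbinom (n : nat) (s : R) : R :=
  match n with
  | O => 1
  | S m => gbinom m s * (s - INR m) / INR (S m)
  end.

Lemma gbinom_step (n : nat) (s : R) :
  (s - INR n) * gbinom n s = INR (S n) * gbinom (S n) s.
Proof.
  cbn [gbinom]. field. apply not_0_INR. discriminate.
Qed.

(** With [F = (1+x)^s ln(1+x)], this is the coefficient of [x^n] in [(1+x) F' = s F + (1+x)^s]. It
    is also what differentiating the recurrence of [gbinom] in [s] produces. *)
Lemma gbinom_log_coef_step (n : nat) (s : R) :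
  let L := PS_mult (fun k => gbinom k s) log_coef in
  INR (S n) * L (S n) = L n * (s - INR n) + gbinom n s.
Proof.
  intros L. set (P := fun k => gbinom k s).
  change (INR (S n) * sum_f_R0 (fun k => P k * log_coef (S n - k)) (S n)
    = sum_f_R0 (fun k => P k * log_coef (n - k)) n * (s - INR n) + P n).
  (* These are the coefficients of [x / (1+x)], which is [x] times the derivative of [ln (1+x)]. *)
  set (e := fun m => INR m * log_coef m).
  assert (He : forall m, e (S m) = (-1) ^ m).
  { intros m. apply PS_derive_log_coef. }
  assert (He0 : e O = 0) by (unfold e; simpl; ring).
  (* The weight [S n] is split as [k + (S n - k)]. *)
  assert (HL : INR (S n) * sum_f_R0 (fun k => P k * log_coef (S n - k)) (S n)
     = sum_f_R0 (fun k => INR k * P k * log_coef (S n - k)) (S n)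
       + sum_f_R0 (fun k => (-1) ^ (n - k) * P k) n).
  { replace (sum_f_R0 (fun k => (-1) ^ (n - k) * P k) n)
      with (sum_f_R0 (fun k => e (S n - k)%nat * P k) (S n)).
    - rewrite scal_sum, <- sum_plus. apply sum_eq. intros k Hk. unfold e.
      rewrite minus_INR by exact Hk. ring.
    - rewrite tech5, Nat.sub_diag, He0, Rmult_0_l, Rplus_0_r.
      apply sum_eq. intros k Hk.
      now rewrite Nat.sub_succ_l, He by exact Hk. }
  (* Here [s - n] is split as [(s - k) - (n - k)]; by [gbinom_step] the first part shifts the index
     by one. *)
  assert (HR : sum_f_R0 (fun k => P k * log_coef (n - k)) n * (s - INR n)
     = sum_f_R0 (fun k => INR k * P k * log_coef (S n - k)) (S n)
       - sum_f_R0 (fun k => e (n - k)%nat * P k) n).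
  { rewrite (decomp_sum (fun k => INR k * P k * log_coef (S n - k))) by lia. simpl pred.
    rewrite Rmult_comm, scal_sum. simpl (INR 0). rewrite !Rmult_0_l, Rplus_0_l.
    rewrite <- minus_sum. apply sum_eq. intros k Hk. unfold e, P.
    rewrite <- gbinom_step, Nat.sub_succ, minus_INR by exact Hk. ring. }
  (* For [k < n] the two terms have opposite signs and cancel; only [k = n] survives, since
     [e 0 = 0]. *)
  assert (HP : sum_f_R0 (fun k => (-1) ^ (n - k) * P k) n
     + sum_f_R0 (fun k => e (n - k)%nat * P k) n = P n).
  { rewrite <- sum_plus. destruct n as [| n].
    - simpl. rewrite He0. ring.
    - rewrite tech5, Nat.sub_diag, He0, sum_eq_R0; [simpl; ring |].
      intros k Hk. rewrite Nat.sub_succ_l, He by exact Hk. simpl. ring. }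
  rewrite HL, HR. lra.
Qed.

(* This is [d/ds (1+x)^s = ln(1+x) (1+x)^s] read on coefficients of [x]. *)
Lemma is_derive_gbinom (n : nat) (s : R) :
  is_derive (gbinom n) s (PS_mult (fun k => gbinom k s) log_coef n).
Proof.
  induction n as [| n IH].
  - unfold PS_mult. simpl. rewrite Rmult_0_r.
    apply (is_derive_const (K := R_AbsRing) (V := R_NormedModule)).
  - assert (Hn : INR (S n) <> 0) by (apply not_0_INR; discriminate).
    set (L := PS_mult (fun k => gbinom k s) log_coef) in *.
    assert (E : L (S n) = (L n * (s - INR n) + gbinom n s) / INR (S n)).
    { apply Rmult_eq_reg_l with (INR (S n)); [| exact Hn].
      unfold L. rewrite gbinom_log_coef_step. field. exact Hn. }
    assert (Hext : forall t, / INR (S n) * (gbinom n t * (t - INR n)) = gbinom (S n) t).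
    { intros t. cbn [gbinom]. field. exact Hn. }
    rewrite E.
    apply is_derive_ext with (1 := Hext).
    replace ((L n * (s - INR n) + gbinom n s) / INR (S n))
      with (/ INR (S n) * (L n * (s - INR n) + gbinom n s * 1)) by (field; exact Hn).
    apply is_derive_scal.
    apply (is_derive_mult (gbinom n) (fun t => t - INR n) s (L n) 1);
      [exact IH | | intros; apply Rmult_comm].
    auto_derive; [exact I | ring].
Qed.

Lemma continuous_gbinom (n : nat) (s : R) : continuous (gbinom n) s.
Proof.
  apply (ex_derive_continuous (K := R_AbsRing) (V := R_NormedModule)).
  eexists. apply is_derive_gbinom.
Qed.

Lemma gbinom_0 (n : nat) : gbinom (S n) 0 = 0.
Proof.
  induction n as [| n IH].
  - simpl. field.
  - cbn [gbinom] in *. rewrite IH. unfold Rdiv. ring.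
Qed.

Lemma gbinom_1 (n : nat) : gbinom (S (S n)) 1 = 0.
Proof.
  induction n as [| n IH].
  - simpl. field.
  - change (gbinom (S (S n)) 1 * (1 - INR (S (S n))) / INR (S (S (S n))) = 0).
    rewrite IH. unfold Rdiv. ring.
Qed.

Lemma is_RInt_sum_f_R0 (f : nat -> R -> R) (l : nat -> R) (a b : R) (n : nat) :
  (forall k, is_RInt (f k) a b (l k)) ->
  is_RInt (fun s => sum_f_R0 (fun k => f k s) n) a b (sum_f_R0 l n).
Proof.
  intros H. induction n as [| n IH]; simpl; [apply H |].
  apply (is_RInt_plus (V := R_NormedModule)); [exact IH | apply H].
Qed.

(** The integrals satisfy the same convolution equation as [b]: their product with [log_coef] is the
    integral of the [s]-derivative of [gbinom n], hence [gbinom n 1 - gbinom n 0], the coefficient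
    of [x^n] in [(1+x) - 1]. Only finite sums are exchanged with the integral. *)
Lemma bernoulli_second_kind_RInt (b : nat -> R) :
  is_bernoulli_second_kind b -> forall n, is_RInt (gbinom n) 0 1 (b n).
Proof.
  intros Hb.
  assert (Hex : forall n, is_RInt (gbinom n) 0 1 (RInt (gbinom n) 0 1)).
  { intros n. apply (RInt_correct (V := R_CompleteNormedModule)).
    apply (ex_RInt_continuous (V := R_CompleteNormedModule)).
    intros z _. apply continuous_gbinom. }
  intros n. replace (b n) with (RInt (gbinom n) 0 1); [apply Hex |].
  symmetry. revert n.
  apply PS_mult_log_coef_inj. intros n.
  rewrite (bernoulli_second_kind_conv b Hb n).
  set (L := fun s => PS_mult (fun k => gbinom k s) log_coef n).
  assert (H1 : is_RInt L 0 1
            (PS_mult (fun k => RInt (gbinom k) 0 1) log_coef n)).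
  { unfold L, PS_mult.
    apply (is_RInt_sum_f_R0 (fun k s => gbinom k s * log_coef (n - k))).
    intros k. rewrite Rmult_comm.
    apply is_RInt_ext with (fun s => scal (log_coef (n - k)) (gbinom k s)).
    - intros s _. apply Rmult_comm.
    - apply (is_RInt_scal (V := R_NormedModule)). apply Hex. }
  assert (H2 : is_RInt L 0 1 (minus (gbinom n 1) (gbinom n 0))).
  { apply (is_RInt_derive (V := R_CompleteNormedModule)).
    - intros s _. apply is_derive_gbinom.
    - intros s _. unfold L, PS_mult. clear.
      assert (Hs : forall m, continuous
        (fun t => sum_f_R0 (fun k => gbinom k t * log_coef (n - k)) m) s).
      { intros m. induction m as [| m IH]; cbn [sum_f_R0].
        - apply (continuous_mult (K := R_AbsRing));
            [apply continuous_gbinom | apply continuous_const].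
        - apply (continuous_plus (K := R_AbsRing) (V := R_NormedModule)); [exact IH |].
          apply (continuous_mult (K := R_AbsRing));
            [apply continuous_gbinom | apply continuous_const]. }
      apply Hs. }
  rewrite <- (is_RInt_unique _ _ _ _ H1), (is_RInt_unique _ _ _ _ H2).
  destruct n as [| [| n]]; unfold minus, plus, opp; simpl plus; simpl opp.
  - simpl. ring.
  - simpl. field.
  - rewrite gbinom_1, gbinom_0. simpl. ring.
Qed.

(** * Beta moments: sign, difference rule and decay *)

Fixpoint rising (x : R) (n : nat) : R :=
  match n with
  | O => 1
  | S m => rising x m * (x + INR m)
  end.

Lemma rising_nonneg (x : R) (n : nat) : 0 <= x -> 0 <= rising x n.
Proof.
  intros Hx. induction n as [| n IH]; simpl; [lra |].
  apply Rmult_le_pos; [exact IH |]. pose proof (pos_INR n). lra.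
Qed.

(* Up to a positive factor depending on [s], the Beta integral of
   [t^(n-s) (1-t)^(k+s)]. *)
Definition beta_moment (s : R) (n k : nat) : R :=
  s * rising (1 - s) n * rising (1 + s) k / INR (fact (S (n + k))).

Lemma beta_moment_nonneg (s : R) (n k : nat) :
  0 <= s <= 1 -> 0 <= beta_moment s n k.
Proof.
  intros Hs. unfold beta_moment.
  apply Rdiv_le_0_compat; [| apply INR_fact_lt_0].
  repeat apply Rmult_le_pos; try apply rising_nonneg; lra.
Qed.

(** In the Beta integral, the extra factor [1 - t] is split into its two terms. *)
Lemma beta_moment_step (s : R) (n k : nat) :
  beta_moment s n (S k) = beta_moment s n k - beta_moment s (S n) k.
Proof.
  unfold beta_moment. rewrite Nat.add_succ_r, Nat.add_succ_l.
  rewrite (fact_simpl (S (n + k))), mult_INR.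
  cbn [rising]. rewrite !S_INR, plus_INR.
  pose proof (INR_fact_neq_0 (S (n + k))).
  pose proof (pos_INR n). pose proof (pos_INR k).
  field. split; lra.
Qed.

Lemma beta_moment_gbinom (s : R) (n : nat) :
  beta_moment s n 0 = (-1) ^ n * gbinom (S n) s.
Proof.
  induction n as [| n IH].
  - unfold beta_moment. simpl. field.
  - change (gbinom (S (S n)) s)
      with (gbinom (S n) s * (s - INR (S n)) / INR (S (S n))).
    replace ((-1) ^ S n * (gbinom (S n) s * (s - INR (S n)) / INR (S (S n))))
      with ((-1) ^ n * gbinom (S n) s * (INR (S n) - s) / INR (S (S n)))
      by (simpl; unfold Rdiv; ring).
    rewrite <- IH. unfold beta_moment. rewrite !Nat.add_0_r.
    rewrite (fact_simpl (S n)), mult_INR. cbn [rising]. rewrite !S_INR.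
    pose proof (INR_fact_neq_0 (S n)). pose proof (pos_INR n).
    field. split; lra.
Qed.

Lemma ln_succ_le (x : R) : 0 < x -> ln (x + 1) - ln x <= / x.
Proof.
  intros Hx. rewrite <- ln_div by lra.
  replace ((x + 1) / x) with (1 + / x) by (field; lra).
  pose proof (Rinv_0_lt_compat x Hx).
  rewrite <- (ln_exp (/ x)) at 2. apply ln_le; [lra |]. apply exp_ineq1_le.
Qed.

Lemma exp_le (x y : R) : x <= y -> exp x <= exp y.
Proof.
  intros [H | ->]; [left; now apply exp_increasing | apply Rle_refl].
Qed.

(** The left side is the product of [1 - (1-s)/j] over [1 <= j <= k+1]. Each factor is at most
    [exp (-(1-s)/j)], and the harmonic sum up to [k+1] is at least [ln (k+2)]. *)
Lemma beta_moment_0_le (s : R) (k : nat) :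
  0 <= s <= 1 -> beta_moment s 0 k <= exp (- (1 - s) * ln (INR (S (S k)))).
Proof.
  intros Hs. induction k as [| k IH].
  - apply Rle_trans with (exp (- (1 - s))).
    + replace (beta_moment s 0 0) with (1 + - (1 - s)).
      * apply exp_ineq1_le.
      * unfold beta_moment. simpl. field.
    (* The base case needs only [ln 2 <= 1]. *)
    + apply exp_le.
      pose proof (ln_succ_le 1 Rlt_0_1) as H. rewrite ln_1, Rinv_1 in H.
      simpl INR. nra.
  - set (x := INR (S (S k))) in *.
    assert (Hx : 0 < x) by (apply lt_0_INR; lia).
    rewrite (S_INR (S (S k))). fold x.
    replace (beta_moment s 0 (S k)) with (beta_moment s 0 k * (1 + - ((1 - s) / x))).
    + replace (- (1 - s) * ln (x + 1))
        with (- (1 - s) * ln x + - (1 - s) * (ln (x + 1) - ln x)) by ring.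
      rewrite exp_plus.
      apply Rle_trans with (beta_moment s 0 k * exp (- ((1 - s) / x))).
      * apply Rmult_le_compat_l; [now apply beta_moment_nonneg | apply exp_ineq1_le].
      * apply Rmult_le_compat; [now apply beta_moment_nonneg | left; apply exp_pos
          | exact IH |].
        apply exp_le. pose proof (ln_succ_le x Hx).
        unfold Rdiv. nra.
    + unfold beta_moment. rewrite Nat.add_succ_r, (fact_simpl (S (0 + k))), mult_INR.
      cbn [rising]. simpl (0 + k)%nat. fold x.
      replace (INR k) with (x - 2) by (unfold x; rewrite !S_INR; ring).
      pose proof (INR_fact_neq_0 (S k)). field. split; [exact H | lra].
Qed.

(** * Finite differences and the effect of lowering the head *)

Lemma delta_0 (mu : nat -> R) (n : nat) : delta 0 mu n = mu n.
Proof.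
  unfold delta. simpl. rewrite C_n_n, Nat.add_0_r, Nat.sub_0_r. ring.
Qed.

Lemma C_n_0 (n : nat) : Binomial.C n 0 = 1.
Proof.
  rewrite pascal_step1 by lia. rewrite Nat.sub_0_r. apply C_n_n.
Qed.

(** Pascal's rule turns the closed form of [delta] into the recursion used by every later
    induction. *)
Lemma delta_S (k : nat) (mu : nat -> R) (n : nat) :
  delta (S k) mu n = delta k mu (S n) - delta k mu n.
Proof.
  unfold delta.
  set (f := fun m => mu (n + S k - m)%nat).
  rewrite (sum_eq _ (fun m => (-1) ^ m * Binomial.C (S k) m * f m)) by reflexivity.
  rewrite (sum_eq (fun m => (-1) ^ m * Binomial.C k m * mu (S n + k - m)%nat)
             (fun m => (-1) ^ m * Binomial.C k m * f m))
    by (intros; unfold f; now rewrite Nat.add_succ_r).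
  rewrite (sum_eq (fun m => (-1) ^ m * Binomial.C k m * mu (n + k - m)%nat)
             (fun m => (-1) ^ m * Binomial.C k m * f (S m)))
    by (intros; unfold f; now rewrite Nat.add_succ_r).
  rewrite decomp_sum by lia. simpl pred. rewrite C_n_0.
  (* [pascal] covers only interior indices, so both end terms are peeled off, which requires a
     positive [k]. *)
  destruct k as [| k].
  - simpl. rewrite !C_n_n. ring.
  - rewrite (decomp_sum (fun m => (-1) ^ m * Binomial.C (S k) m * f m)) by lia.
    simpl pred. rewrite !tech5, !C_n_n, C_n_0.
    rewrite (sum_eq _ (fun i => (-1) ^ S i * Binomial.C (S k) (S i) * f (S i)
                          - (-1) ^ i * Binomial.C (S k) i * f (S i))).
    + rewrite minus_sum. simpl. ring.
    + intros i Hi. rewrite <- pascal by lia. simpl. ring.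
Qed.

Lemma delta_decrease_head_S (eps : R) (a : nat -> R) (k n : nat) :
  delta k (decrease_head eps a) (S n) = delta k a (S n).
Proof.
  revert n. induction k as [| k IH]; intros n.
  - now rewrite !delta_0.
  - now rewrite !delta_S, !IH.
Qed.

(** Once multiplied by [(-1) ^ k], every difference at 0 drops by the same [eps], whatever [k]
    is. *)
Lemma delta_decrease_head_0 (eps : R) (a : nat -> R) (k : nat) :
  delta k (decrease_head eps a) 0 = delta k a 0 - (-1) ^ k * eps.
Proof.
  induction k as [| k IH].
  - rewrite !delta_0. simpl. ring.
  - rewrite !delta_S, delta_decrease_head_S, IH. simpl. ring.
Qed.

Lemma pow_neg1_sqr (k : nat) : (-1) ^ k * (-1) ^ k = 1.
Proof.
  rewrite <- Rpow_mult_distr. replace (-1 * -1) with 1 by ring. apply pow1.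
Qed.

(** * Integral representation of the differences and their bound at 0 *)

(** [beta_moment_step] mirrors [delta_S] up to the sign, so induction on [k] carries the integral
    formula for [b] over to all differences. *)
Lemma is_RInt_delta (b : nat -> R) (n k : nat) :
  is_bernoulli_second_kind b ->
  is_RInt (fun s => beta_moment s n k) 0 1
    ((-1) ^ k * delta k (fun n => (-1) ^ n * b (S n)) n).
Proof.
  intros Hb. revert n. induction k as [| k IH]; intros n.
  - rewrite delta_0, pow_O, Rmult_1_l.
    apply is_RInt_ext with (fun s => scal ((-1) ^ n) (gbinom (S n) s)).
    + intros s _. symmetry. apply beta_moment_gbinom.
    + apply (is_RInt_scal (V := R_NormedModule)). now apply bernoulli_second_kind_RInt.
  - rewrite delta_S.
    match goal with |- is_RInt _ _ _ ((-1) ^ S k * (?u - ?v)) =>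
      replace ((-1) ^ S k * (u - v)) with (minus ((-1) ^ k * v) ((-1) ^ k * u))
    end.
    + apply is_RInt_ext
        with (fun s => minus (beta_moment s n k) (beta_moment s (S n) k)).
      * intros s _. symmetry. apply beta_moment_step.
      * apply (is_RInt_minus (V := R_NormedModule)); apply IH.
    + unfold minus, plus, opp. simpl. ring.
Qed.

(** With [l = ln (k+2)], integrating the bound [exp (-(1-s) l)] over [0, 1] gives
    [(1 - exp (-l)) / l], which is below [1 / l]. *)
Lemma delta_head_le (b : nat -> R) (k : nat) :
  is_bernoulli_second_kind b ->
  (-1) ^ k * delta k (fun n => (-1) ^ n * b (S n)) 0 <= / ln (INR (S (S k))).
Proof.
  intros Hb. set (l := ln (INR (S (S k)))).
  assert (Hl : 0 < l).
  { unfold l. rewrite <- ln_1. apply ln_increasing; [lra |].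
    change 1 with (INR 1). apply lt_INR. lia. }
  assert (HI : is_RInt (fun s => exp (- (1 - s) * l)) 0 1
            (minus (exp (- (1 - 1) * l) / l) (exp (- (1 - 0) * l) / l))).
  { apply (is_RInt_derive (fun s => exp (- (1 - s) * l) / l)).
    - intros s _. auto_derive; [exact I | unfold Rminus; field; lra].
    - intros s _. apply (ex_derive_continuous (K := R_AbsRing) (V := R_NormedModule)).
      auto_derive. exact I. }
  eapply Rle_trans.
  { apply (is_RInt_le _ _ 0 1 _ _ Rle_0_1 (is_RInt_delta b 0 k Hb) HI).
    intros s Hs. apply beta_moment_0_le. lra. }
  unfold minus, plus, opp. simpl.
  replace (- (1 - 1) * l) with 0 by ring. rewrite exp_0.
  assert (0 < exp (- (1 - 0) * l) / l) by (apply Rdiv_lt_0_compat; [apply exp_pos | exact Hl]).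
  unfold Rdiv in *. lra.
Qed.

Theorem theorem1p2 (b : nat -> R) (hb : is_bernoulli_second_kind b) :
  completely_monotonic (fun n : nat => (-1) ^ n * b (S n)) /\
  minimal (fun n : nat => (-1) ^ n * b (S n)).
Proof.
  set (mu := fun n : nat => (-1) ^ n * b (S n)).
  assert (Hd : forall n k, 0 <= (-1) ^ k * delta k mu n).
  { intros n k.
    assert (H0 : is_RInt (fun _ : R => 0) 0 1 (scal (1 - 0) 0))
      by apply (is_RInt_const (V := R_NormedModule)).
    change (scal (1 - 0) 0) with ((1 - 0) * 0) in H0. rewrite Rmult_0_r in H0.
    apply is_RInt_le with (f := fun _ => 0) (g := fun s => beta_moment s n k)
      (a := 0) (b := 1).
    - lra.
    - exact H0.
    - now apply is_RInt_delta.
    - intros s Hs. apply beta_moment_nonneg. lra. }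
  assert (Hcm : completely_monotonic mu).
  { split; [| exact Hd].
    intros n. rewrite <- (delta_0 mu n), <- (Rmult_1_l (delta 0 mu n)). apply (Hd n O). }
  split; [exact Hcm | split; [exact Hcm |]].
  intros eps Heps [_ H].
  (* This [k] makes [ln (k+2)] exceed [1 / eps], so the signed difference at 0 is smaller than [eps]
     and turns negative once the head is lowered. *)
  destruct (INR_unbounded (exp (/ eps))) as [k Hk].
  specialize (H O k).
  rewrite delta_decrease_head_0, Rmult_minus_distr_l, <- Rmult_assoc, pow_neg1_sqr in H.
  pose proof (delta_head_le b k hb) as Hle. fold mu in Hle.
  assert (Hln : / eps < ln (INR (S (S k)))).
  { rewrite <- (ln_exp (/ eps)). apply ln_increasing; [apply exp_pos |].
    rewrite !S_INR. lra. }
  apply Rinv_lt_contravar in Hln.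
  - rewrite Rinv_inv in Hln. lra.
  - pose proof (Rinv_0_lt_compat eps Heps). apply Rmult_lt_0_compat; lra.
Qed.
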